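(* Every rigidity circuit $C$ can be obtained inductively by applying combinatorial resultant operations starting from $K_4$ circuits. Precisely: for every rigidity circuit $C$ there is a finite rooted binary tree (every internal node has exactly two children) whose nodes are labeled by rigidity circuits, such that the root is labeled by $C$, every leaf is labeled by a complete graph on $4$ vertices, and for every internal node labeled $G$ with children labeled $G_1,G_2$ there is a common edge $e$ of $G_1$ and $G_2$ with $G=\operatorname{CRes}(G_1,G_2,e)$.
   Context: All graphs are finite and simple; subgraphs of a complete graph $K_N$ on labeled vertices. A graph $G=(V,E)$ is $(2,3)$-sparse if every subset $V'\subseteq V$ with $|V'|\ge 2$ spans at most $2|V'|-3$ edges of $G$. The $(2,3)$-sparse edge sets are the independent sets of a matroid on the edges of $K_N$ (the generic 2D rigidity matroid). A rigidity circuit is a graph without isolated vertices whose edge set is a circuit (minimal dependent set) of this matroid. The smallest example is $K_4$. Combinatorial resultant: for two distinct graphs $G_1=(V_1,E_1)$ and $G_2=(V_2,E_2)$ with a common edge $e\in E_1\cap E_2$, $\operatorname{CRes}(G_1,G_2,e)$ is the graph with vertex set $V_1\cup V_2$ and edge set $(E_1\cup E_2)\setminus\{e\}$. *)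

(* Defs.v *)
From mathcomp Require Import all_boot.

Set Implicit Arguments.
Unset Strict Implicit.
Unset Printing Implicit Defensive.

(* Finite simple graphs whose vertices are drawn from the label set T, that is,
   the subgraphs of the complete graph on T. An edge is a 2-element vertex
   set; equality of graphs is equality of both vertex and edge sets. *)
Record sgraph (T : finType) := SGraph {
  verts : {set T};
  edges : {set {set T}};
  edgesP : [forall e in edges, (#|e| == 2) && (e \subset verts)]
}.

Definition complete_edges (T : finType) (V : {set T}) : {set {set T}} :=
  [set e : {set T} | (#|e| == 2) && (e \subset V)].

Definition spanned_edges (T : finType) (E : {set {set T}}) (V' : {set T}) :
    {set {set T}} :=
  [set e in E | e \subset V'].

(* Truncation of the subtraction is harmless as 2 <= #|V'|. *)
Definition sparse23 (T : finType) (V : {set T}) (E : {set {set T}}) : bool :=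
  [forall V' : {set T}, (V' \subset V) && (2 <= #|V'|) ==>
     (#|spanned_edges E V'| <= 2 * #|V'| - 3)].

(* The generic 2D rigidity matroid; its ground set is the edge set of the
   complete graph on T. *)
Definition rigidity_indep (T : finType) (E : {set {set T}}) : bool :=
  (E \subset complete_edges [set: T]) && sparse23 [set: T] E.

Definition rigidity_dep (T : finType) (E : {set {set T}}) : bool :=
  (E \subset complete_edges [set: T]) && ~~ rigidity_indep E.

Definition no_isolated (T : finType) (G : sgraph T) : bool :=
  [forall v in verts G, exists e in edges G, v \in e].

Definition rigidity_circuit (T : finType) (G : sgraph T) : bool :=
  no_isolated G && minset (@rigidity_dep T) (edges G).

Definition is_K4 (T : finType) (G : sgraph T) : bool :=
  (#|verts G| == 4) && (edges G == complete_edges (verts G)).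

Lemma CRes_edgesP (T : finType) (G1 G2 : sgraph T) (e : {set T}) :
  [forall f in (edges G1 :|: edges G2) :\ e,
     (#|f| == 2) && (f \subset verts G1 :|: verts G2)].
Proof.
apply/forall_inP => f /setD1P[_ /setUP[]] fE.
- have /forall_inP/(_ f fE)/andP[-> /= sub] := edgesP G1.
  exact: subset_trans sub (subsetUl _ _).
- have /forall_inP/(_ f fE)/andP[-> /= sub] := edgesP G2.
  exact: subset_trans sub (subsetUr _ _).
Qed.

(* Total in G1, G2 and e; the side conditions G1 <> G2 and e a common edge are
   imposed where the operation is used. *)
Definition CRes (T : finType) (G1 G2 : sgraph T) (e : {set T}) : sgraph T :=
  SGraph (CRes_edgesP G1 G2 e).

Inductive lbtree (A : Type) :=
| Leaf of A
| Node of A & lbtree A & lbtree A.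

Definition root_label (A : Type) (t : lbtree A) : A :=
  match t with Leaf G => G | Node G _ _ => G end.

Fixpoint resultant_tree (T : finType) (t : lbtree (sgraph T)) : Prop :=
  match t with
  | Leaf G => rigidity_circuit G /\ is_K4 G
  | Node G t1 t2 =>
      [/\ rigidity_circuit G,
          root_label t1 <> root_label t2,
          (exists e : {set T},
             [/\ e \in edges (root_label t1), e \in edges (root_label t2)
               & G = CRes (root_label t1) (root_label t2) e]),
          resultant_tree t1
        & resultant_tree t2]
  end.

(* Main.v *)
Require Import Defs.
From mathcomp Require Import all_boot.
From mathcomp Require Import zify.

(** Let [C] be a rigidity circuit on [n] vertices. Counting degrees, [C] has at
    least four vertices of degree 3, and if these are pairwise adjacent then
    [C] is a [K4]. Otherwise pick two nonadjacent vertices [u], [w] of degree 3.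
    Then [C - u - w] has [2 (n - 2) - 4] edges, so a pair [e] of its vertices
    can be added to it without losing independence. On the other hand [C - u]
    and [C - w] are tight, so adding [e] to either of them creates circuits [A]
    and [B] through [e]. They are distinct, as a common circuit would lie in
    [C - u - w + e]. Eliminating [e], the set [A :|: B :\ e] is dependent and
    contained in [C], hence equal to [C]; and [A], [B] have fewer vertices than
    [C]. *)

Set Implicit Arguments.
Unset Strict Implicit.
Unset Printing Implicit Defensive.

(* Normalizes the type of the elements of [{set {set T}}], which otherwise
   occurs in several convertible forms that [lia] takes for distinct atoms. *)
Ltac card_lia := intros; unfold reverse_coercion in *; simpl in *; lia.

(** * Independent edge sets and the edges they span *)

Section RigidityMatroid.

Variable T : finType.
Implicit Types (E F A B : {set {set T}}) (X Y Z W V e : {set T}).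

Lemma rigidity_indepP F :
  reflect (F \subset complete_edges [set: T] /\
           forall X, 2 <= #|X| -> #|spanned_edges F X| <= 2 * #|X| - 3)
          (rigidity_indep F).
Proof.
apply: (iffP andP) => [] [sF spF]; split=> //.
  by move=> X X2; have /forallP/(_ X) := spF; rewrite subsetT X2.
by apply/forallP => X; apply/implyP => /andP[_]; exact: spF.
Qed.

Lemma edge_card2 F e : F \subset complete_edges [set: T] -> e \in F -> #|e| = 2.
Proof. by move=> /subsetP sF /sF; rewrite inE => /andP[/eqP]. Qed.

Lemma spanned_edges_sub F X : spanned_edges F X \subset F.
Proof. by apply/subsetP => e; rewrite inE => /andP[]. Qed.

Lemma spanned_edgesI F X Y :
  spanned_edges F X :&: spanned_edges F Y = spanned_edges F (X :&: Y).
Proof. by apply/setP => e; rewrite !inE subsetI; case: (e \in F). Qed.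

Lemma spanned_edgesS F X Y :
  X \subset Y -> spanned_edges F X \subset spanned_edges F Y.
Proof.
move=> sXY; apply/subsetP => e; rewrite !inE => /andP[-> /=] sX.
exact: subset_trans sX sXY.
Qed.

Lemma spanned_edges_small F X :
  F \subset complete_edges [set: T] -> #|X| < 2 -> spanned_edges F X = set0.
Proof.
move=> sF X1; apply/setP => e; rewrite !inE; apply/negP => /andP[eF].
by move/subset_leq_card; rewrite (edge_card2 sF eF) leqNgt X1.
Qed.

Lemma spanned_edges_cover F X : cover F \subset X -> spanned_edges F X = F.
Proof.
move=> sFX; apply/setP => e; rewrite inE andb_idr // => eF.
exact: subset_trans (bigcup_sup e eF) sFX.
Qed.

Lemma rigidity_indepS F E : F \subset E -> rigidity_indep E -> rigidity_indep F.
Proof.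
move=> sFE /rigidity_indepP[sE spE]; apply/rigidity_indepP; split.
  exact: subset_trans sFE sE.
move=> X X2; apply: leq_trans (spE X X2); apply: subset_leq_card.
by apply/subsetP => e; rewrite !inE => /andP[/(subsetP sFE)-> ->].
Qed.

(** * Tight vertex sets and augmentation *)

Definition tight F X : bool :=
  (2 <= #|X|) && (#|spanned_edges F X| == 2 * #|X| - 3).

(** The number of spanned edges is supermodular and [2 * #|X| - 3] is modular. As the intersection
    has at least two vertices, it obeys the sparsity bound, so the union must attain it. *)
Lemma tightU F X Y : rigidity_indep F -> tight F X -> tight F Y ->
  2 <= #|X :&: Y| -> tight F (X :|: Y).
Proof.
move=> /rigidity_indepP[sF spF] /andP[X2 /eqP tX] /andP[Y2 /eqP tY] XY2.
have U2 : 2 <= #|X :|: Y|.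
  by apply: leq_trans X2 (subset_leq_card (subsetUl _ _)).
have /subset_leq_card : spanned_edges F X :|: spanned_edges F Y
    \subset spanned_edges F (X :|: Y).
  by rewrite subUset !spanned_edgesS ?subsetUl ?subsetUr.
have := cardsUI (spanned_edges F X) (spanned_edges F Y).
rewrite spanned_edgesI; have := cardsUI X Y.
move: (spF _ XY2) (spF _ U2); rewrite /tight U2 /=; card_lia.
Qed.

Lemma card_setU3_disjoint (I : finType) (P Q R : {set I}) :
  P :&: Q = set0 -> P :&: R = set0 -> Q :&: R = set0 ->
  #|P :|: Q :|: R| = #|P| + #|Q| + #|R|.
Proof.
move=> PQ PR QR; have := cardsUI (P :|: Q) R; have := cardsUI P Q.
by rewrite setIUl PQ PR QR setU0 cards0; card_lia.
Qed.

(** Sets meeting in single vertices share no edge, so the edge counts add up to 2s - 9, where s is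
    the sum of the three sizes. The union has s - 3 vertices, and 2(s - 3) - 3 = 2s - 9. *)
Lemma tightU3 F X Y Z x y z : rigidity_indep F ->
  tight F X -> tight F Y -> tight F Z ->
  X :&: Y = [set x] -> X :&: Z = [set z] -> Y :&: Z = [set y] -> x != y ->
  tight F (X :|: Y :|: Z).
Proof.
move=> /rigidity_indepP[sF spF] /andP[X2 /eqP tX] /andP[Y2 /eqP tY].
move=> /andP[Z2 /eqP tZ] XY XZ YZ xy.
have U2 : 2 <= #|X :|: Y :|: Z|.
  by apply: leq_trans Z2 (subset_leq_card (subsetUr _ _)).
have /subset_leq_card : spanned_edges F X :|: spanned_edges F Y
    :|: spanned_edges F Z \subset spanned_edges F (X :|: Y :|: Z).
  have sX : X \subset X :|: Y :|: Z by rewrite -setUA subsetUl.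
  have sY : Y \subset X :|: Y :|: Z by rewrite setUAC subsetUr.
  by rewrite !subUset !spanned_edgesS ?subsetUr.
rewrite card_setU3_disjoint ?spanned_edgesI ?XY ?XZ ?YZ;
  try by rewrite spanned_edges_small // cards1.
have := cardsUI (X :|: Y) Z; have := cardsUI X Y.
(* This makes [(X :|: Y) :&: Z] a set of exactly two vertices. *)
have zy : z != y.
  apply: contraNneq xy => zy; have : z \in X :&: Y.
    have : z \in X :&: Z by rewrite XZ set11.
    have : z \in Y :&: Z by rewrite YZ zy set11.
    by rewrite !inE => /andP[-> _] /andP[->].
  by rewrite XY inE zy eq_sym.
rewrite setIUl XY XZ YZ cards1 cards2 zy.
by move: (spF _ U2); rewrite /tight U2 /=; card_lia.
Qed.

(** If the pair is already an edge, it is itself a tight set, as 2 * 2 - 3 = 1. Otherwise adding it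
    breaks the bound on some [X], which must contain both ends and attain the bound beforehand. *)
Lemma tight_of_unextendable F a b : rigidity_indep F -> a != b ->
  ~~ (([set a; b] \notin F) && rigidity_indep ([set a; b] |: F)) ->
  exists2 X, tight F X & (a \in X) && (b \in X).
Proof.
move=> iF ab; have [sF spF] := rigidity_indepP _ iF.
have c2 : #|[set a; b]| = 2 by rewrite cards2 ab.
rewrite negb_and negbK => /orP[eF|].
  exists [set a; b]; last by rewrite !inE !eqxx orbT.
  have : [set [set a; b]] \subset spanned_edges F [set a; b].
    by rewrite sub1set inE eF subxx.
  move/subset_leq_card; rewrite cards1 => h.
  by have := spF [set a; b]; rewrite /tight c2 eqn_leq h andbT => ->.
have sE : [set a; b] |: F \subset complete_edges [set: T].
  by rewrite subUset sF andbT sub1set inE c2 subsetT.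
rewrite /rigidity_indep sE /= => /forallPn[X]; rewrite negb_imply subsetT /=.
move=> /andP[X2]; rewrite -ltnNge => bX.
have abX : [set a; b] \subset X.
  apply: contraTT bX => nX; rewrite -leqNgt; apply: leq_trans (spF X X2).
  apply: subset_leq_card; apply/subsetP => e; rewrite !inE.
  by case: eqP => [->|_ //]; rewrite (negbTE nX).
exists X; last by move: abX; rewrite subUset !sub1set.
have /subset_leq_card : spanned_edges ([set a; b] |: F) X
    \subset [set a; b] |: spanned_edges F X.
  by apply/subsetP => e; rewrite !inE; case: eqP.
rewrite cardsU1; move: (spF X X2) bX; rewrite /tight.
by case: (_ \notin _) => /=; card_lia.
Qed.

Lemma setI_eq1 X Y x : x \in X -> x \in Y -> #|X :&: Y| < 2 -> X :&: Y = [set x].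
Proof.
move=> xX xY h; apply/esym/eqP; rewrite eqEcard sub1set inE xX xY cards1 /=.
by rewrite -ltnS.
Qed.

(* If every pair of vertices of [W] spans a dependency with [F], then a maximal
   tight set contains [W]: otherwise glue it along a triangle to two tight sets
   through a common vertex outside of it. *)
Lemma rigidity_augment F W : rigidity_indep F -> 2 <= #|W| ->
  #|F| < 2 * #|W| - 3 ->
  exists a b, [/\ a \in W, b \in W, a != b, [set a; b] \notin F
                & rigidity_indep ([set a; b] |: F)].
Proof.
move=> iF W2 cF.
case: (boolP [exists a in W, exists b in W, [&& a != b, [set a; b] \notin F
                & rigidity_indep ([set a; b] |: F)]]).
  by move=> /exists_inP[a aW /exists_inP[b bW /and3P[? ? ?]]]; exists a, b.
move=> /exists_inPn none; exfalso.
have pair a b : a \in W -> b \in W -> a != b ->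
    exists2 X, tight F X & (a \in X) && (b \in X).
  move=> aW bW ab; apply: tight_of_unextendable => //.
  by have /exists_inPn/(_ b bW) := none a aW; rewrite ab.
have /card_gt1P[p [q [pW qW pq]]] := W2.
have [X0 tX0 /andP[pX0 qX0]] := pair p q pW qW pq.
have [X /maxsetP[tX maxX] sX0] := @maxset_exists _ (tight F) X0 tX0.
have grow Y : tight F Y -> 2 <= #|X :&: Y| -> Y \subset X.
  move=> tY XY; rewrite -(maxX _ (tightU iF tX tY XY) (subsetUl _ _)).
  exact: subsetUr.
have [pX qX] := (subsetP sX0 _ pX0, subsetP sX0 _ qX0).
(* A tight set containing [W] would give [F] at least [2 * #|W| - 3] edges, against [cF]. *)
have [sWX|/subsetPn[y yW yX]] := boolP (W \subset X).
  have /andP[X2 /eqP tXe] := tX.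
  move: (subset_leq_card sWX) (subset_leq_card (spanned_edges_sub F X)).
  by clear -X2 W2 cF tXe; card_lia.
have py : p != y by apply: contraNneq yX => <-.
have qy : q != y by apply: contraNneq yX => <-.
have [Y tY /andP[pY yY]] := pair p y pW yW py.
have [Z tZ /andP[qZ yZ]] := pair q y qW yW qy.
have small V : tight F V -> y \in V -> #|X :&: V| < 2.
  move=> tV yV; rewrite ltnNge; apply: contraNN yX => /(grow _ tV)/subsetP.
  exact.
have XY := setI_eq1 pX pY (small Y tY yY).
have XZ := setI_eq1 qX qZ (small Z tZ yZ).
(* With two common vertices, [Y :|: Z] would be tight; it contains [y] and meets [X] in both [p] and
   [q], contrary to [small]. *)
have YZ : Y :&: Z = [set y].
  apply: setI_eq1 => //; rewrite ltnNge; apply/negP => YZ2.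
  have := small _ (tightU iF tY tZ YZ2); rewrite inE yY => /(_ isT).
  apply/negP; rewrite -leqNgt; apply/card_gt1P; exists p, q.
  by rewrite !inE pX qX pY qZ orbT.
have tU := tightU3 iF tX tY tZ XY XZ YZ py.
have sXU : X \subset X :|: Y :|: Z by rewrite -setUA subsetUl.
by move: yX; rewrite -(maxX _ tU sXU) !inE yY orbT.
Qed.

(** * Edge and degree counts in circuits *)

Section Circuit.

Variable E : {set {set T}}.
Hypothesis minE : minset (@rigidity_dep T) E.

Lemma circuit_edges : E \subset complete_edges [set: T].
Proof. by case/minsetP: minE => /andP[]. Qed.

Lemma proper_circuit_indep F : F \proper E -> rigidity_indep F.
Proof.
case/andP=> sFE nEF; case/minsetP: minE => _ min.
apply: contraNT nEF => nF; rewrite [F]min //.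
by rewrite /rigidity_dep nF (subset_trans sFE circuit_edges).
Qed.

(** By minimality a vertex set violating sparsity spans all of [E], which bounds [#|E|] from below;
    deleting one edge restores sparsity, which bounds it from above. The additive form avoids
    truncated subtraction. *)
Lemma circuit_card : #|E| + 2 = 2 * #|cover E| /\ 2 <= #|cover E|.
Proof.
have sE := circuit_edges.
case/minsetP: (minE) => /andP[_]; rewrite /rigidity_indep sE /=.
move=> /forallPn[X]; rewrite negb_imply subsetT -ltnNge => /andP[X2 /= bX] _.
have spX : spanned_edges E X = E.
  apply/eqP; apply: contraTT bX => nE; rewrite -leqNgt.
  have /rigidity_indepP[_ /(_ X X2)] : rigidity_indep (spanned_edges E X).
    by apply: proper_circuit_indep; rewrite properEneq nE spanned_edges_sub.
  by congr (_ <= _); apply: eq_card => e; rewrite !inE -andbA andbb.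
rewrite spX in bX.
have sVX : cover E \subset X.
  by apply/bigcupsP => e; rewrite -[E]spX inE => /andP[].
have [e eE] : exists e, e \in E by apply/card_gt0P; apply: leq_trans bX.
have V2 : 2 <= #|cover E|.
  by rewrite -(edge_card2 sE eE); apply/subset_leq_card/bigcup_sup.
have /rigidity_indepP[_ /(_ _ V2)] := proper_circuit_indep (properD1 eE).
rewrite spanned_edges_cover; last first.
  apply/bigcupsP => f /setD1P[_ fE]; exact: bigcup_sup.
have := cardsD1 e E; rewrite eE.
by move: (subset_leq_card sVX); split; card_lia.
Qed.

(** Some edge has an end outside [X]; deleting it leaves an independent set with the same edges
    inside [X]. *)
Lemma card_spanned_proper X : 2 <= #|X| -> X \proper cover E ->
  #|spanned_edges E X| <= 2 * #|X| - 3.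
Proof.
move=> X2 /properP[sX [v /bigcupP[e eE ve] vX]].
have /rigidity_indepP[_ /(_ _ X2)] := proper_circuit_indep (properD1 eE).
apply: leq_trans; apply: subset_leq_card; apply/subsetP => f.
rewrite !inE => /andP[fE fX]; rewrite fE fX !andbT.
by apply: contraNneq vX => fe; rewrite (subsetP fX) // fe.
Qed.

(** On 2 or 3 vertices, 2n - 2 exceeds the number of available pairs. *)
Lemma circuit_card_cover : 4 <= #|cover E|.
Proof.
have [cE V2] := circuit_card.
have : E \subset [set e : {set T} | e \subset cover E & #|e| == 2].
  apply/subsetP => e eE; rewrite inE (edge_card2 circuit_edges eE) eqxx andbT.
  exact: bigcup_sup.
move/subset_leq_card; rewrite cards_draws bin2.
case: #|cover E| cE V2 => [|[|[|[|n]]]] //=; card_lia.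
Qed.

Definition degree F v := #|[set e in F | v \in e]|.

Lemma card_spannedD1 X v :
  #|spanned_edges E (X :\ v)| + #|[set e in spanned_edges E X | v \in e]|
  = #|spanned_edges E X|.
Proof.
rewrite -(cardsID [set e : {set T} | v \in e] (spanned_edges E X)) addnC.
by congr (_ + _); apply: eq_card => e; rewrite !inE // subsetD1 andbA andbC.
Qed.

Lemma card_coverD1 v :
  #|spanned_edges E (cover E :\ v)| + degree E v = #|E|.
Proof.
by have := card_spannedD1 (cover E) v; rewrite (spanned_edges_cover (subxx _)).
Qed.

(** Of the 2n - 2 edges, at most 2(n - 1) - 3 = 2n - 5 avoid [v]. *)
Lemma circuit_degree v : v \in cover E -> 3 <= degree E v.
Proof.
move=> vE; have [cE _] := circuit_card; have n4 := circuit_card_cover.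
have := card_coverD1 v; have := cardsD1 v (cover E); rewrite vE.
have /card_spanned_proper := properD1 vE; card_lia.
Qed.

Lemma circuit_sum_degree : \sum_(v in cover E) degree E v = 2 * #|E|.
Proof.
rewrite mulnC -sum_nat_const.
transitivity (\sum_(v in cover E) \sum_(e in E | v \in e) 1).
  by apply: eq_bigr => v _; rewrite /degree -sum1_card; apply: eq_bigl => e; rewrite inE.
rewrite (exchange_big_dep (mem E)) /= => [|v e _ /andP[]//].
apply: eq_bigr => e eE; rewrite -(edge_card2 circuit_edges eE) -sum1_card.
apply: eq_bigl => v; rewrite eE /= andb_idl // => ve.
by apply/bigcupP; exists e.
Qed.

(** The degrees sum to 4n - 4 and are at least 3. Adding 1 at each vertex of degree 3 makes every
    term at least 4, so at least four vertices receive the 1. *)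
Lemma circuit_degree3 : 4 <= #|[set v in cover E | degree E v == 3]|.
Proof.
set D := [set v in _ | _]; have [cE _] := circuit_card.
have : \sum_(v in cover E) 4 <=
       \sum_(v in cover E) (degree E v + (degree E v == 3)).
  by apply: leq_sum => v /circuit_degree; case: ltngtP => //; card_lia.
rewrite big_split /= circuit_sum_degree sum_nat_const.
have -> : \sum_(v in cover E) (degree E v == 3) = #|D|.
  by rewrite -sum1_card -big_mkcondr; apply: eq_bigl => v; rewrite inE.
card_lia.
Qed.

(** Four vertices of [Q] span 6 edges, while a proper subset of four vertices spans at most 5. Hence
    they are all the vertices, and a circuit on them has exactly 6 edges. *)
Lemma circuit_K4 (Q : {set T}) : 4 <= #|Q| -> Q \subset cover E ->
  (forall u w, u \in Q -> w \in Q -> u != w -> [set u; w] \in E) ->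
  #|cover E| = 4 /\ E = complete_edges (cover E).
Proof.
move=> Q4 sQ adj.
have [P sPQ cP] : exists2 P : {set T}, P \subset Q & #|P| = 4.
  have : 0 < #|[set P : {set T} | P \subset Q & #|P| == 4]|.
    by rewrite cards_draws bin_gt0.
  by case/card_gt0P=> P; rewrite inE => /andP[? /eqP]; exists P.
have spP : complete_edges P \subset spanned_edges E P.
  apply/subsetP => e; rewrite !inE => /andP[/cards2P[u [w [uw ->]]] eP].
  rewrite eP andbT; move: eP; rewrite subUset !sub1set => /andP[uP wP].
  by apply: adj => //; apply: (subsetP sPQ).
have c6 : #|complete_edges P| = 6.
  transitivity 'C(#|P|, 2); last by rewrite cP.
  by rewrite -cards_draws; apply: eq_card => e; rewrite !inE andbC.
have PV : P = cover E.
  apply/eqP; rewrite eqEproper (subset_trans sPQ sQ) /=; apply/negP => prP.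
  have := card_spanned_proper _ prP; rewrite cP => /(_ isT).
  by have := subset_leq_card spP; rewrite c6; card_lia.
rewrite -PV cP; split=> //; apply/esym/eqP.
rewrite eqEcard (subset_trans spP (spanned_edges_sub _ _)) c6 /=.
by have [] := circuit_card; rewrite -PV cP; card_lia.
Qed.

End Circuit.

(* Both circuits have [2 #|cover _| - 2] edges while their intersection is
   independent and lives on the common vertices. *)
Lemma circuit_elimination A B e :
  minset (@rigidity_dep T) A -> minset (@rigidity_dep T) B -> A != B ->
  e \in A -> e \in B -> rigidity_dep ((A :|: B) :\ e).
Proof.
move=> mA mB AB eA eB.
have [[cA A2] [cB B2]] := (circuit_card mA, circuit_card mB).
have [sA sB] := (circuit_edges mA, circuit_edges mB).
have sAB : (A :|: B) :\ e \subset complete_edges [set: T].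
  by apply: subset_trans (subsetDl _ _) _; rewrite subUset sA sB.
rewrite /rigidity_dep sAB /=; apply/negP => /rigidity_indepP[_ spAB].
have prA : A :&: B \proper A.
  rewrite properEneq subsetIl andbT; apply: contraNneq AB => /setIidPl sAB'.
  by case/minsetP: mB => _ /(_ A) -> //; case/minsetP: mA.
have sI : e \subset cover A :&: cover B.
  by rewrite subsetI; apply/andP; split; apply: bigcup_sup.
have I2 : 2 <= #|cover A :&: cover B|.
  by rewrite -(edge_card2 sA eA); apply: subset_leq_card.
have U2 : 2 <= #|cover A :|: cover B|.
  by apply: leq_trans A2 (subset_leq_card (subsetUl _ _)).
have /rigidity_indepP[_ /(_ _ I2)] := proper_circuit_indep mA prA.
rewrite spanned_edges_cover; last first.
  apply/bigcupsP => f /setIP[fA fB]; rewrite subsetI.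
  by apply/andP; split; apply: bigcup_sup.
have := spAB _ U2; rewrite spanned_edges_cover; last first.
  apply/bigcupsP => f /setD1P[_ /setUP[]] fE.
    exact: subset_trans (bigcup_sup f fE) (subsetUl _ _).
  exact: subset_trans (bigcup_sup f fE) (subsetUr _ _).
(* With U the union of the covers, [A :|: B] has at least 2|U| - 1 edges, so 2|U| - 2 remain without
   [e], one too many for sparsity. *)
have := cardsD1 e (A :|: B); rewrite inE eA /=.
have := cardsUI A B; have := cardsUI (cover A) (cover B).
have : #|A :&: B| > 0 by apply/card_gt0P; exists e; rewrite inE eA eB.
by clear -cA cB A2 B2 I2 U2; card_lia.
Qed.

(** * Splitting a circuit into two smaller ones *)

Lemma circuit_decomposition E : minset (@rigidity_dep T) E ->
  (#|cover E| = 4 /\ E = complete_edges (cover E)) \/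
  exists A B e,
    [/\ minset (@rigidity_dep T) A, minset (@rigidity_dep T) B, A != B,
        (e \in A) && (e \in B) & (A :|: B) :\ e = E] /\
    [/\ #|cover A| < #|cover E|, #|cover B| < #|cover E|
      & cover A :|: cover B = cover E].
Proof.
move=> mE; have [cE V2] := circuit_card mE; have n4 := circuit_card_cover mE.
pose D := [set v in cover E | degree E v == 3].
case: (boolP [exists u in D, exists w in D,
               (u != w) && ([set u; w] \notin E)]); last first.
  move=> /exists_inPn none; left; apply: (@circuit_K4 E mE D).
  - exact: circuit_degree3.
  - by apply/subsetP => v; rewrite inE => /andP[].
  - move=> u w uD wD uw; have /exists_inPn/(_ w wD) := none u uD.
    by rewrite uw negbK.
move=> /exists_inP[u uD /exists_inP[w wD /andP[uw nuw]]]; right.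
move: uD wD; rewrite !inE => /andP[uV /eqP du] /andP[wV /eqP dw].
pose V := cover E; pose W := V :\ u :\ w; rewrite -/V in cE V2 n4 uV wV *.
have cW : #|W| + 2 = #|V|.
  have := cardsD1 w (V :\ u); have := cardsD1 u V.
  by rewrite !inE uV wV eq_sym uw /= -/W; card_lia.
have cF : #|spanned_edges E W| + 6 = #|E|.
  have := card_spannedD1 E (V :\ u) w; have := card_coverD1 E u.
  (* As [u] and [w] are nonadjacent, deleting [u] keeps all three edges at [w]. *)
  have -> : [set e in spanned_edges E (V :\ u) | w \in e]
            = [set e in E | w \in e].
    apply/setP => e; rewrite !inE; case: (boolP (e \in E)) => //= eE.
    rewrite subsetD1 (bigcup_sup e eE) /=.
    case: (boolP (w \in e)); rewrite ?andbF ?andbT // => we.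
    apply: contraNN nuw => ue; suff -> : [set u; w] = e by [].
    apply/eqP; rewrite eqEcard subUset !sub1set ue we cards2 uw.
    by rewrite (edge_card2 (circuit_edges mE) eE).
  by rewrite -/(degree E w) -/V -/W du dw; card_lia.
have prD v : v \in V -> spanned_edges E (V :\ v) \proper E.
  case/bigcupP=> e eE ve; apply/properP; split; first exact: spanned_edges_sub.
  by exists e; rewrite // inE subsetD1 ve !andbF.
have iF : rigidity_indep (spanned_edges E W).
  apply: rigidity_indepS (proper_circuit_indep mE (prD u uV)).
  exact/spanned_edgesS/subsetDl.
(* The edges left number 2n - 8 = 2(n - 2) - 4, one less than tightness of [W] requires. *)
have [||a [b [aW bW ab nab iab]]] := rigidity_augment (W := W) iF.
- by card_lia.
- by card_lia.
set e := [set a; b] in nab iab.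
have eW : e \subset W by rewrite subUset !sub1set aW.
have nE : e \notin E by apply: contraNN nab => eE; rewrite inE eE eW.
have c2 : #|e| = 2 by rewrite cards2 ab.
(* Removing a vertex of degree 3 leaves 2n - 5 = 2(n - 1) - 3 edges on n - 1 vertices, so the extra
   edge [e] breaks sparsity. *)
have build v : v \in V -> degree E v = 3 -> W \subset V :\ v ->
    exists A, [/\ minset (@rigidity_dep T) A,
                  A \subset e |: spanned_edges E (V :\ v), e \in A
                & cover A \subset V :\ v].
  move=> vV dv sW; have cV := cardsD1 v V; rewrite vV in cV.
  have eV := subset_trans eW sW.
  have sc : cover (e |: spanned_edges E (V :\ v)) \subset V :\ v.
    by apply/bigcupsP => f; rewrite !inE => /predU1P[->//|/andP[]].
  have : rigidity_dep (e |: spanned_edges E (V :\ v)).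
    have sK : e |: spanned_edges E (V :\ v) \subset complete_edges [set: T].
      rewrite subUset sub1set inE c2 subsetT /=.
      exact: subset_trans (spanned_edges_sub _ _) (circuit_edges mE).
    have Vv2 : 2 <= #|V :\ v| by clear -cV n4; card_lia.
    rewrite /rigidity_dep sK; apply/negP => /rigidity_indepP[_ /(_ _ Vv2)].
    rewrite spanned_edges_cover // cardsU1 inE (negbTE nE) /=.
    have := card_coverD1 E v; rewrite -/V dv; clear -cE cV n4.
    by rewrite add1n; card_lia.
  case/minset_exists=> A mA sA; exists A; split=> //.
    (* A circuit avoiding [e] would lie properly inside [E], where everything is independent. *)
    apply: contraT => neA; case/minsetP: (mA) => /andP[_ /negP[]].
    apply: rigidity_indepS (proper_circuit_indep mE (prD v vV)).
    apply/subsetP => f fA; have := subsetP sA f fA; case/setU1P=> // fe.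
    by rewrite -fe fA in neA.
  apply: subset_trans sc; apply/bigcupsP => f fA.
  by apply: bigcup_sup; apply: (subsetP sA).
have [||A [mA sA eA cA]] := build u uV; rewrite ?subsetDl //.
have [||B [mB sB eB cB]] := build w wV => //; first by rewrite setSD ?subsetDl.
have AB : A != B.
  apply/eqP => AB; case/minsetP: (mA) => /andP[_ /negP[]].
  apply: rigidity_indepS iab; apply/subsetP => f fA.
  have := subsetP sA f fA; rewrite AB in fA; have := subsetP sB f fA.
  rewrite !inE; case: eqP => //= _ /andP[-> ]; rewrite !subsetD1 /=.
  by move=> /andP[-> ->] /= ->.
have EAB : (A :|: B) :\ e = E.
  case/minsetP: (mE) => _; apply; first exact: circuit_elimination.
  apply/subsetP => f /setD1P[/negbTE fe /setUP[/(subsetP sA)|/(subsetP sB)]];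
    by rewrite !inE fe => /andP[].
exists A, B, e; split; split=> //.
- by rewrite eA.
- by apply: leq_ltn_trans (subset_leq_card cA) (proper_card (properD1 uV)).
- by apply: leq_ltn_trans (subset_leq_card cB) (proper_card (properD1 wV)).
(* [CRes] keeps all vertices of both graphs, so the covers have to agree even though [e] is
   removed. *)
apply/eqP; rewrite eqEsubset subUset (subset_trans cA (subsetDl _ _)).
rewrite (subset_trans cB (subsetDl _ _)) /=.
apply/bigcupsP => f; rewrite -{1}EAB => /setD1P[_ /setUP[]] fE.
  exact: subset_trans (bigcup_sup f fE) (subsetUl _ _).
exact: subset_trans (bigcup_sup f fE) (subsetUr _ _).
Qed.

(** * From edge sets to graphs, and the tree *)

Lemma sgraph_eq (G H : sgraph T) :
  verts G = verts H -> edges G = edges H -> G = H.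
Proof.
case: G H => [V E hE] [V' E' hE'] /= eV eE; subst V' E'.
by rewrite (bool_irrelevance hE hE').
Qed.

Lemma rigidity_circuit_verts (G : sgraph T) :
  rigidity_circuit G -> verts G = cover (edges G).
Proof.
case/andP=> /forall_inP noI _; apply/eqP; rewrite eqEsubset; apply/andP; split.
  by apply/subsetP => v /noI /exists_inP[e eG ve]; apply/bigcupP; exists e.
by apply/bigcupsP => e eG; have /forall_inP/(_ e eG)/andP[] := edgesP G.
Qed.

Lemma circuit_graph E : minset (@rigidity_dep T) E ->
  exists G : sgraph T,
    [/\ rigidity_circuit G, verts G = cover E & edges G = E].
Proof.
move=> mE.
have hE : [forall e in E, (#|e| == 2) && (e \subset cover E)].
  apply/forall_inP => e eE.
  by rewrite (edge_card2 (circuit_edges mE) eE) eqxx bigcup_sup.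
exists (SGraph hE); split=> //; rewrite /rigidity_circuit mE andbT.
by apply/forall_inP => v /bigcupP[e eE ve]; apply/exists_inP; exists e.
Qed.

End RigidityMatroid.

Theorem theorem1 (T : finType) (C : sgraph T) (hC : rigidity_circuit C) :
  exists t : lbtree (sgraph T), root_label t = C /\ resultant_tree t.
Proof.
(* Strong induction on the number of vertices, which drops for both circuits of a decomposition. *)
have [n] := ubnP #|verts C|; elim: n => // n IHn in C hC *; rewrite ltnS => Cn.
have vC := rigidity_circuit_verts hC.
have /andP[_ mC] := hC; rewrite vC in Cn.
case: (circuit_decomposition mC) => [[c4 K4]|[A [B [e [[mA mB AB]]]]]].
  by exists (Leaf C); split=> //; split=> //; rewrite /is_K4 vC c4 -K4 !eqxx.
move=> /andP[eA eB] EAB [cA cB VAB].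
have [GA [hA vA EA]] := circuit_graph mA.
have [GB [hB vB EB]] := circuit_graph mB.
have [|tA [rA treeA]] := IHn GA hA; first by rewrite vA (leq_trans cA).
have [|tB [rB treeB]] := IHn GB hB; first by rewrite vB (leq_trans cB).
exists (Node C tA tB); split=> //=; rewrite rA rB; split=> //.
  by move=> GAB; move: AB; rewrite -EA -EB GAB eqxx.
exists e; rewrite EA EB; split=> //.
by apply: sgraph_eq => /=; rewrite ?vA ?vB ?EA ?EB ?VAB ?EAB.
Qed.
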